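(* As formal power series in $q$, $$\sum_{i=0}^{\infty}\frac{q^{2i^2}}{\prod_{k=1}^{2i}(1-q^k)}=\varphi(q)\frac{f(q^5,q^3)}{D_2},\qquad \sum_{i=0}^{\infty}\frac{q^{2i^2+2i}}{\prod_{k=1}^{2i+1}(1-q^k)}=\varphi(q)\frac{f(q,q^7)}{D_2},$$ where $D_2=f(q^5,q^3)^2-q\,f(q,q^7)^2$.
   Context: $f(u,v)=\sum_{j=-\infty}^\infty u^{j(j-1)/2}v^{j(j+1)/2}$ and $\varphi(q)=\prod_{j=1}^\infty(1-q^j)$. *)

(* Defs.v *)
From HB Require Import structures.
From mathcomp Require Import all_boot all_order all_algebra.
From mathcomp Require Import all_classical.
From mathcomp Require Import zify ring lra.

Set Implicit Arguments.
Unset Strict Implicit.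
Unset Printing Implicit Defensive.

Import Order.TTheory GRing.Theory Num.Theory.
Local Open Scope classical_set_scope.
Local Open Scope ring_scope.

(* Formal power series over R, as coefficient sequences with the Cauchy
   product; a series is a unit iff its constant coefficient is one. *)
Record fps (R : Type) := Fps { fps_coef : nat -> R }.

HB.instance Definition _ (R : Type) := [isNew for @fps_coef R].
HB.instance Definition _ (R : choiceType) := [Choice of fps R by <:].

Lemma fpsP (R : Type) (a b : fps R) :
  (forall n, fps_coef a n = fps_coef b n) -> a = b.
Proof. by case: a b => [a] [b] /= /funext ->. Qed.

Section Zmodule.
Variable R : zmodType.
Implicit Types a b c : fps R.

Definition fps0 : fps R := Fps (fun=> 0).
Definition fps_opp a : fps R := Fps (fun n => - fps_coef a n).
Definition fps_add a b : fps R := Fps (fun n => fps_coef a n + fps_coef b n).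

Fact fps_addA : associative fps_add.
Proof. by move=> a b c; apply: fpsP => n /=; rewrite addrA. Qed.
Fact fps_addC : commutative fps_add.
Proof. by move=> a b; apply: fpsP => n /=; rewrite addrC. Qed.
Fact fps_add0 : left_id fps0 fps_add.
Proof. by move=> a; apply: fpsP => n /=; rewrite add0r. Qed.
Fact fps_addN : left_inverse fps0 fps_opp fps_add.
Proof. by move=> a; apply: fpsP => n /=; rewrite addNr. Qed.

HB.instance Definition _ :=
  GRing.isZmodule.Build (fps R) fps_addA fps_addC fps_add0 fps_addN.

Lemma coef_fps0 n : fps_coef (0 : fps R) n = 0. Proof. by []. Qed.
Lemma coef_fpsD a b n : fps_coef (a + b) n = fps_coef a n + fps_coef b n.
Proof. by []. Qed.
Lemma coef_fpsN a n : fps_coef (- a) n = - fps_coef a n. Proof. by []. Qed.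
Lemma coef_fpsB a b n : fps_coef (a - b) n = fps_coef a n - fps_coef b n.
Proof. by []. Qed.

End Zmodule.

Section Ring.
Variable R : comNzRingType.
Implicit Types a b c : fps R.

Definition fps1 : fps R := Fps (fun n => (n == 0)%:R).
Definition fps_mul a b : fps R :=
  Fps (fun n => \sum_(i < n.+1) fps_coef a i * fps_coef b (n - i)).

Let trunc N a : {poly R} := \poly_(i < N) fps_coef a i.

Let coef_mul_trunc N a b n : (n < N)%N ->
  fps_coef (fps_mul a b) n = (trunc N a * trunc N b)`_n.
Proof.
move=> nN; rewrite coefM /=; apply: eq_bigr => i _; rewrite !coef_poly.
by rewrite (leq_ltn_trans _ nN) ?(leq_ltn_trans (leq_subr _ _) nN) // -ltnS.
Qed.

Let eq_coefM (p p' r : {poly R}) n :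
  (forall i, (i <= n)%N -> p`_i = p'`_i) -> (p * r)`_n = (p' * r)`_n.
Proof.
by move=> e; rewrite !coefM; apply: eq_bigr => i _; rewrite e // -ltnS.
Qed.

Fact fps_mulC : commutative fps_mul.
Proof.
by move=> a b; apply: fpsP => n; rewrite !(@coef_mul_trunc n.+1) // mulrC.
Qed.

Fact fps_mulA : associative fps_mul.
Proof.
move=> a b c; apply: fpsP => n; rewrite !(@coef_mul_trunc n.+1) //.
have tm x y i : (i <= n)%N ->
    (trunc n.+1 (fps_mul x y))`_i = (trunc n.+1 x * trunc n.+1 y)`_i.
  by move=> le_in; rewrite coef_poly ltnS le_in (@coef_mul_trunc n.+1).
by rewrite mulrC (eq_coefM _ (tm b c)) (eq_coefM _ (tm a b)) mulrC mulrA.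
Qed.

Fact fps_mul1 : left_id fps1 fps_mul.
Proof.
move=> a; apply: fpsP => n /=; rewrite big_ord_recl /= mul1r subn0 big1 ?addr0//.
by move=> i _; rewrite mul0r.
Qed.

Fact fps_mulDl : left_distributive fps_mul (@fps_add R).
Proof.
move=> a b c; apply: fpsP => n /=; rewrite -big_split /=.
by apply: eq_bigr => i _; rewrite mulrDl.
Qed.

Fact fps_oner_neq0 : fps1 != 0.
Proof.
apply/eqP => /(congr1 (fun a => fps_coef a 0)) /= /eqP.
by rewrite oner_eq0.
Qed.

HB.instance Definition _ := GRing.Zmodule_isComNzRing.Build (fps R)
  fps_mulA fps_mulC fps_mul1 fps_mulDl fps_oner_neq0.

Definition fpsX : fps R := Fps (fun n => (n == 1)%:R).

Lemma coef_fps1 n : fps_coef (1 : fps R) n = (n == 0)%:R. Proof. by []. Qed.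

Lemma coef_fpsM a b n :
  fps_coef (a * b) n = \sum_(i < n.+1) fps_coef a i * fps_coef b (n - i).
Proof. by []. Qed.

Lemma coef0_fpsM a b :
  fps_coef (a * b) 0 = fps_coef a 0 * fps_coef b 0.
Proof. by rewrite coef_fpsM big_ord1. Qed.

Lemma coef_fpsXn k n : fps_coef (fpsX ^+ k) n = (n == k)%:R.
Proof.
elim: k n => [|k IH] n; first by rewrite expr0.
rewrite exprS coef_fpsM.
case: n => [|n]; first by rewrite big_ord1 /= mul0r.
rewrite big_ord_recl /= mul0r add0r big_ord_recl /= mul1r big1 ?addr0.
  by rewrite subSS subn0 IH.
by move=> i _; rewrite mul0r.
Qed.

Lemma coef_fpsXnM k a n :
  fps_coef (fpsX ^+ k * a) n = if (n < k)%N then 0 else fps_coef a (n - k).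
Proof.
rewrite coef_fpsM; case: ltnP => [nk|kn].
  rewrite big1 // => i _; rewrite coef_fpsXn.
  by case: eqP => [ik|_]; rewrite ?mul0r //; have := ltn_ord i; lia.
have kn' : (k < n.+1)%N by [].
rewrite (bigD1 (Ordinal kn')) //= coef_fpsXn eqxx mul1r big1 ?addr0 //.
move=> i; rewrite -val_eqE /= => /negPf ik.
by rewrite coef_fpsXn ik mul0r.
Qed.

End Ring.

Arguments fpsX {R}.

Section UnitRing.
Variable R : comUnitRingType.
Implicit Types a b c : fps R.

(* fps_inv_seq a n lists the coefficients of a^-1 from degree n down to 0 *)
Fixpoint fps_inv_seq a (n : nat) : seq R :=
  if n is m.+1 then
    let s := fps_inv_seq a m in
    - (fps_coef a 0)^-1 * (\sum_(i < m.+1) fps_coef a i.+1 * s`_i) :: s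
  else [:: (fps_coef a 0)^-1].

Definition fps_unit : {pred fps R} :=
  [pred a | fps_coef a 0 \is a GRing.unit].
Definition fps_inv a : fps R :=
  if a \in fps_unit then Fps (fun n => (fps_inv_seq a n)`_0) else a.

Let nth_inv_seq a n i : (i <= n)%N ->
  (fps_inv_seq a n)`_i = (fps_inv_seq a (n - i))`_0.
Proof.
by elim: n i => [|n IH] [|i] // le_in; rewrite subSS -IH.
Qed.

Fact fps_mulVr : {in fps_unit, left_inverse 1 fps_inv *%R}.
Proof.
move=> a ua; rewrite mulrC /fps_inv ua; apply: fpsP => -[|n].
  by rewrite coef_fpsM big_ord1 /= divrr.
rewrite coef_fpsM big_ord_recl /= mulNr mulrN mulVKr // addrC.
apply/eqP; rewrite subr_eq0; apply/eqP/eq_bigr => i _.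
rewrite [in RHS]nth_inv_seq; last by rewrite -ltnS.
rewrite /=.
by rewrite /bump leq0n add1n subSS.
Qed.

Fact fps_unitPl a b : b * a = 1 -> a \in fps_unit.
Proof.
move=> /(congr1 (fun c => fps_coef c 0)); rewrite coef0_fpsM /= => ba.
by apply/unitrPr; exists (fps_coef b 0); rewrite mulrC.
Qed.

Fact fps_inv_out : {in [predC fps_unit], fps_inv =1 id}.
Proof. by move=> a /negPf ua; rewrite /fps_inv ua. Qed.

HB.instance Definition _ := GRing.ComNzRing_hasMulInverse.Build (fps R)
  fps_mulVr fps_unitPl fps_inv_out.

Lemma fps_unitE a :
  (a \is a GRing.unit) = (fps_coef a 0 \is a GRing.unit).
Proof. by []. Qed.

End UnitRing.

Section Infinite.
Variable R : comNzRingType.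

Definition fps_summable (I : choiceType) (F : I -> fps R) :=
  forall n, finite_set [set i | fps_coef (F i) n != 0].

(* Each coefficient sum has finite support when F is summable; a sum with
   infinite support is 0 by convention. *)
Definition fps_sum (I : choiceType) (F : I -> fps R) : fps R :=
  Fps (fun n => \sum_(i \in [set: I]) fps_coef (F i) n).

(* Coefficientwise eventual value, i.e. the limit for the X-adic topology; coefficients that
   do not stabilize are 0 by convention. *)
Definition fps_lim (a : nat -> fps R) : fps R :=
  Fps (fun n => xget 0 [set c | \forall N \near \oo, fps_coef (a N) n = c]).

Definition fps_cvg (a : nat -> fps R) (l : fps R) :=
  forall n, \forall N \near \oo, fps_coef (a N) n = fps_coef l n.

Lemma fps_cvg_lim a l : fps_cvg a l -> fps_lim a = l.
Proof.
move=> al; apply: fpsP => n /=; apply: xget_unique; first exact: al.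
move=> c [M _ cM]; have [N _ lN] := al n.
have /= <- := cM (maxn M N) (leq_maxl _ _).
by have /= <- := lN (maxn M N) (leq_maxr _ _).
Qed.

End Infinite.

Section Theta.
Variable R : comUnitRingType.

(* Both exponents are nonnegative integers for every j. *)
Definition theta_term (u v : fps R) (j : int) : fps R :=
  u ^ ((j * (j - 1)) %/ 2)%Z * v ^ ((j * (j + 1)) %/ 2)%Z.

Definition theta (u v : fps R) : fps R := fps_sum (theta_term u v).

Definition euler_phi (x : fps R) : fps R :=
  fps_lim (fun N => \prod_(1 <= j < N.+1) (1 - x ^+ j)).

End Theta.

Definition q : fps int := fpsX.

Definition D2 : fps int :=
  theta (q ^+ 5) (q ^+ 3) ^+ 2 - q * theta q (q ^+ 7) ^+ 2.

Lemma dvd2_mulz_pred (j : int) : (2 %| j * (j - 1))%Z.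
Proof.
have [k [->|->]] : exists k : int, j = k * 2 \/ j = k * 2 + 1.
- by exists (j %/ 2)%Z; lia.
- by rewrite -mulrA mulrCA dvdz_mulr.
- by rewrite addrK mulrCA dvdz_mull // dvdz_mull.
Qed.

Lemma tri_predE (j : int) : ((j * (j - 1)) %/ 2)%Z * 2 = j * (j - 1).
Proof. exact: divzK (dvd2_mulz_pred j). Qed.

Lemma tri_succE (j : int) : ((j * (j + 1)) %/ 2)%Z * 2 = j * (j + 1).
Proof.
by apply: divzK; have := dvd2_mulz_pred (j + 1); rewrite addrK mulrC.
Qed.

Lemma tri_pred_ge0 (j : int) : 0 <= ((j * (j - 1)) %/ 2)%Z.
Proof.
rewrite divz_ge0 //; case: (lerP j 0) => j0.
  by rewrite -mulrNN mulr_ge0 //; lia.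
by rewrite mulr_ge0 //; lia.
Qed.

Lemma tri_succ_ge0 (j : int) : 0 <= ((j * (j + 1)) %/ 2)%Z.
Proof. by have := tri_pred_ge0 (j + 1); rewrite addrK mulrC. Qed.

Lemma theta_termXn (R : comUnitRingType) (a b : nat) (j : int) :
  theta_term (fpsX ^+ a : fps R) (fpsX ^+ b) j =
  fpsX ^+ (a * `|((j * (j - 1)) %/ 2)%Z| + b * `|((j * (j + 1)) %/ 2)%Z|)%N.
Proof.
rewrite /theta_term -{1}(gez0_abs (tri_pred_ge0 j)).
by rewrite -{1}(gez0_abs (tri_succ_ge0 j)) -!exprnP -!exprM -exprD.
Qed.

Lemma theta_exp_ge (a b : nat) (j : int) : (0 < a)%N -> (0 < b)%N ->
  (`|j| <= a * `|((j * (j - 1)) %/ 2)%Z| + b * `|((j * (j + 1)) %/ 2)%Z|)%N.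
Proof.
move=> a0 b0.
move: (tri_predE j) (tri_succE j) (tri_pred_ge0 j) (tri_succ_ge0 j).
set x := ((j * (j - 1)) %/ 2)%Z; set y := ((j * (j + 1)) %/ 2)%Z.
clearbody x y => xE yE x0 y0.
have xyE : x + y = j * j.
  apply: (@mulIf _ (2 : int)) => //.
  by rewrite mulrDl xE yE; ring.
have xy : (`|x| + `|y| = `|j| * `|j|)%N.
  by rewrite -abszM -xyE; lia.
apply: (@leq_trans (`|x| + `|y|)); last by apply: leq_add; apply: leq_pmull.
by rewrite xy; case: (`|j|%N) => // n; apply: leq_pmull.
Qed.

Lemma theta_summable (R : comUnitRingType) (a b : nat) :
  (0 < a)%N -> (0 < b)%N ->
  fps_summable (theta_term (fpsX ^+ a : fps R) (fpsX ^+ b)).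
Proof.
move=> a0 b0 n.
apply: (@sub_finite_set _ _
  ([set` [seq Posz k | k <- iota 0 n.+1]] `|`
   [set` [seq - Posz k | k <- iota 0 n.+1]])); last first.
  by rewrite finite_setU; split; exact: finite_seq.
move=> j; rewrite /mkset theta_termXn coef_fpsXn.
case: (n =P _) => [nE|_]; last by rewrite eqxx.
have := theta_exp_ge j a0 b0; rewrite -nE => jn _.
by case: (lerP 0 j) => j0; [left|right]; rewrite /mkset; apply/mapP;
  exists `|j|%N; rewrite ?mem_iota ?ltnS //; lia.
Qed.

Lemma coef0_prod_1subXn (R : comUnitRingType) (n : nat) :
  fps_coef (\prod_(1 <= k < n.+1) (1 - fpsX ^+ k) : fps R) 0 = 1.
Proof.
elim: n => [|n IH]; first by rewrite big_geq.
rewrite big_nat_recr // coef0_fpsM IH mul1r coef_fpsB coef_fpsXn.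
by rewrite subr0.
Qed.

Lemma even_denom_unit i :
  \prod_(1 <= k < (2 * i).+1) (1 - q ^+ k) \is a GRing.unit.
Proof. by rewrite fps_unitE coef0_prod_1subXn. Qed.

Lemma odd_denom_unit i :
  \prod_(1 <= k < (2 * i + 1).+1) (1 - q ^+ k) \is a GRing.unit.
Proof. by rewrite fps_unitE coef0_prod_1subXn. Qed.

Lemma summable_XnM (e : nat -> nat) (G : nat -> fps int) :
  (forall i, (i <= e i)%N) -> fps_summable (fun i => q ^+ e i * G i).
Proof.
move=> ie n; apply: (@sub_finite_set _ _ [set` iota 0 n.+1]);
  last exact: finite_seq.
move=> i; rewrite /mkset coef_fpsXnM mem_iota.
by case: ltnP => [_|]; [rewrite eqxx|have := ie i; lia].
Qed.

Lemma even_summable : fps_summable (fun i : nat =>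
  q ^+ (2 * i ^ 2) / \prod_(1 <= k < (2 * i).+1) (1 - q ^+ k)).
Proof. by apply: summable_XnM => i; nia. Qed.

Lemma odd_summable : fps_summable (fun i : nat =>
  q ^+ (2 * i ^ 2 + 2 * i) / \prod_(1 <= k < (2 * i + 1).+1) (1 - q ^+ k)).
Proof. by apply: summable_XnM => i; nia. Qed.

Lemma euler_phi_cvg (R : comUnitRingType) :
  fps_cvg (fun N => \prod_(1 <= j < N.+1) (1 - fpsX ^+ j) : fps R)
          (euler_phi fpsX).
Proof.
set P := fun N => _.
pose l : fps R := Fps (fun n => fps_coef (P n) n).
suff Pl : fps_cvg P l by rewrite [euler_phi _](fps_cvg_lim Pl).
move=> n; exists n => // N /= nN; rewrite -(subnKC nN).
elim: (N - n)%N => [|k IH]; first by rewrite addn0.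
have PS m : P m.+1 = P m - fpsX ^+ m.+1 * P m.
  by rewrite /P big_nat_recr //= mulrBr mulr1 [X in _ - X = _]mulrC.
rewrite addnS PS coef_fpsB coef_fpsXnM IH ifT ?subr0 //.
by rewrite ltnS leq_addr.
Qed.

Lemma D2_unit : D2 \is a GRing.unit.
Proof.
have t0 (a b : nat) : (0 < a)%N -> (0 < b)%N ->
    fps_coef (theta (q ^+ a) (q ^+ b)) 0 = 1.
  move=> a0 b0; rewrite [LHS](_ : _ = \sum_(j \in [set 0 : int])
      fps_coef (theta_term (q ^+ a) (q ^+ b) j) 0).
    by rewrite fsbig_set1 theta_termXn coef_fpsXn !mul0r div0z absz0 !muln0.
  apply/esym/fsbig_widen => // j [_ /eqP j0].
  rewrite /preimage /mkset theta_termXn coef_fpsXn.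
  case: (0%N =P _) => // e0; exfalso.
  by have := theta_exp_ge j a0 b0; rewrite -e0 leqn0 absz_eq0 (negPf j0).
have unit_sub (x y : fps int) :
    fps_coef x 0 = 1 -> x ^+ 2 - q * y ^+ 2 \is a GRing.unit.
  move=> x0; rewrite fps_unitE coef_fpsB expr2 !coef0_fpsM x0 mulr1.
  by rewrite [fps_coef q 0]/= mul0r subr0.
exact/unit_sub/(t0 5%N 3%N).
Qed.

(* Main.v *)
(* Write e = f(q^5,q^3), o = f(q,q^7), and let A, B be the two series. With
   p^2 = q, Euler's identity reads A + p B = prod_k (1 + p^(2k-1)), and since
   8j^2 - 2j and 8j^2 + 6j + 1 run over the even and the odd triangular numbers,
   e - p o = sum_T (-p)^T over triangular T. Gauss's identity for that sum gives
   (e - p o)(A + p B) = phi(q). Comparing even and odd parts in p yields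
   e A - q o B = phi(q) and e B = o A, a linear system of determinant D2.
   Gauss's identity is obtained from Shanks' finite form of it. *)
Require Import Defs.
From HB Require Import structures.
From mathcomp Require Import all_boot all_order all_algebra.
From mathcomp Require Import all_classical zify ring.
Set Implicit Arguments.
Unset Strict Implicit.
Unset Printing Implicit Defensive.

Import Order.TTheory GRing.Theory Num.Theory.
Local Open Scope ring_scope.

Lemma sum_ord_double (V : nmodType) (F : nat -> V) m :
  \sum_(i < 2 * m) F i = \sum_(i < m) (F (2 * i)%N + F (2 * i + 1)%N).
Proof.
elim: m => [|m IH]; first by rewrite muln0 !big_ord0.
rewrite mulnS add2n !big_ord_recr /= IH addrA.
by rewrite addn1.
Qed.

(** * Congruence modulo powers of the variable *)

Section Congruence.
Variable R : comNzRingType.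
Implicit Types a b c d : fps R.

(** Identities between infinite sums and products are proved on truncations modulo X^N, for every
    N. *)
Definition fps_eqmod N a b :=
  forall n, (n < N)%N -> fps_coef a n = fps_coef b n.

Lemma eqmod_sym N a b : fps_eqmod N a b -> fps_eqmod N b a.
Proof. by move=> ab n /ab. Qed.

Lemma eqmod_trans N b a c :
  fps_eqmod N a b -> fps_eqmod N b c -> fps_eqmod N a c.
Proof. by move=> ab bc n nN; rewrite ab // bc. Qed.

Lemma eqmod_leq M N a b :
  (N <= M)%N -> fps_eqmod M a b -> fps_eqmod N a b.
Proof. by move=> NM ab n nN; apply: ab; apply: leq_trans NM. Qed.

Lemma eqmodD N a b c d :
  fps_eqmod N a b -> fps_eqmod N c d -> fps_eqmod N (a + c) (b + d).
Proof. by move=> ab cd n nN; rewrite !coef_fpsD ab // cd. Qed.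

Lemma eqmodB N a b c d :
  fps_eqmod N a b -> fps_eqmod N c d -> fps_eqmod N (a - c) (b - d).
Proof. by move=> ab cd n nN; rewrite !coef_fpsB ab // cd. Qed.

Lemma eqmodM N a b c d :
  fps_eqmod N a b -> fps_eqmod N c d -> fps_eqmod N (a * c) (b * d).
Proof.
move=> ab cd n nN; rewrite !coef_fpsM; apply: eq_bigr => i _.
have in_n : (i <= n)%N by rewrite -ltnS.
by rewrite ab ?cd // (leq_ltn_trans _ nN) // leq_subr.
Qed.

Lemma eqmod_XnM N k a : (N <= k)%N -> fps_eqmod N (fpsX ^+ k * a) 0.
Proof. by move=> Nk n nN; rewrite coef_fpsXnM (leq_trans nN Nk). Qed.

Lemma eqmod_sum0 N (I : Type) (r : seq I) (P : pred I) (F : I -> fps R) :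
  (forall i, P i -> fps_eqmod N (F i) 0) ->
  fps_eqmod N (\sum_(i <- r | P i) F i) 0.
Proof.
move=> F0; apply: (big_ind (fun s => fps_eqmod N s 0)) => //= a b a0 b0.
by rewrite -[0]addr0; apply: eqmodD.
Qed.

Lemma eqmodP a b : (forall N, fps_eqmod N a b) -> a = b.
Proof. by move=> ab; apply: fpsP => n; apply: (ab n.+1). Qed.

(** A coefficient of degree below N receives contributions from [r] alone, so its sum has finite
    support. *)
Lemma fps_sum_eqmod (I : choiceType) (F : I -> fps R) (r : seq I) N :
  uniq r -> (forall i, i \notin r -> fps_eqmod N (F i) 0) ->
  fps_eqmod N (fps_sum F) (\sum_(i <- r) F i).
Proof.
move=> ur F0 n nN /=.
have -> : fps_coef (\sum_(i <- r) F i) n = \sum_(i <- r) fps_coef (F i) n.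
  by elim/big_rec2: _ => // i x y _ <-; rewrite coef_fpsD.
rewrite [RHS]fsbig_seq //; apply/esym/fsbig_widen => // i [_ /= ir].
by apply: F0 => //; apply/negP.
Qed.

End Congruence.

(** * The substitution of X^2 for X *)

Section Square.
Variable R : comNzRingType.
Implicit Types a b : fps R.

(* a(X) |-> a(X^2) *)
Definition fps_sq a : fps R :=
  Fps (fun n => if odd n then 0 else fps_coef a n./2).
Arguments fps_sq : simpl never.

Lemma coef_fps_sq_even a n : fps_coef (fps_sq a) (2 * n) = fps_coef a n.
Proof. by rewrite /fps_sq /= mul2n odd_double doubleK. Qed.

Lemma coef_fps_sq_odd a n : fps_coef (fps_sq a) (2 * n + 1) = 0.
Proof. by rewrite /fps_sq /= addn1 mul2n /= odd_double. Qed.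

Lemma even_oddP n : exists m, n = (2 * m)%N \/ n = (2 * m + 1)%N.
Proof. by exists n./2; have := odd_double_half n; case: odd; lia. Qed.

Fact fps_sq_zmod_morphism : zmod_morphism fps_sq.
Proof.
move=> a b; apply: fpsP => n; rewrite /fps_sq /=; case: odd => //.
by rewrite subr0.
Qed.

Fact fps_sq_monoid_morphism : monoid_morphism fps_sq.
Proof.
split.
  by apply: fpsP => -[|[|n]] //; rewrite /fps_sq /=; case: odd.
move=> a b; apply: fpsP => n; have [m [->|->]] := even_oddP n.
  pose f i := fps_coef (fps_sq a) i * fps_coef (fps_sq b) (2 * m - i).
  (* Summands of odd index vanish; the indices below 2m pair off and the top one, 2m, stays
     alone. *)
  transitivity (\sum_(i < m) (f (2 * i)%N + f (2 * i + 1)%N) + f (2 * m)%N).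
    rewrite coef_fps_sq_even coef_fpsM big_ord_recr; congr (_ + _).
      apply: eq_bigr => i _.
      by rewrite /f coef_fps_sq_odd mul0r addr0 -mulnBr !coef_fps_sq_even.
    by rewrite /f coef_fps_sq_even !subnn.
  by rewrite -sum_ord_double coef_fpsM big_ord_recr.
rewrite coef_fps_sq_odd coef_fpsM big1 // => i _.
(* In odd degree, i and 2m + 1 - i have opposite parity, so one factor always vanishes. *)
have [k [iE|iE]] := even_oddP i; last by rewrite iE coef_fps_sq_odd mul0r.
have -> : (2 * m + 1 - i = 2 * (m - k) + 1)%N by have := ltn_ord i; lia.
by rewrite coef_fps_sq_odd mulr0.
Qed.

HB.instance Definition _ :=
  GRing.isZmodMorphism.Build (fps R) (fps R) fps_sq fps_sq_zmod_morphism.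
HB.instance Definition _ :=
  GRing.isMonoidMorphism.Build (fps R) (fps R) fps_sq fps_sq_monoid_morphism.

Lemma fps_sqX : fps_sq fpsX = fpsX ^+ 2.
Proof.
apply: fpsP => n; rewrite coef_fpsXn.
have [m [->|->]] := even_oddP n.
  by rewrite coef_fps_sq_even /=; congr (_%:R); lia.
by rewrite coef_fps_sq_odd; case: eqP => //; lia.
Qed.

Lemma fps_sqXn k : fps_sq (fpsX ^+ k) = fpsX ^+ (2 * k).
Proof. by rewrite rmorphXn /= fps_sqX exprM. Qed.

Lemma eqmod_sq N a b :
  fps_eqmod N a b -> fps_eqmod (2 * N) (fps_sq a) (fps_sq b).
Proof.
move=> ab n; have [m [->|->]] := even_oddP n => nN.
  by rewrite !coef_fps_sq_even ab //; lia.
by rewrite !coef_fps_sq_odd.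
Qed.

(** The two summands occupy the even and the odd degrees; this is the comparison of parities in
    p. *)
Lemma fps_sq_even_odd_inj a b c d :
  fps_sq a + fpsX * fps_sq b = fps_sq c + fpsX * fps_sq d -> a = c /\ b = d.
Proof.
have evenE x y n : fps_coef (fps_sq x + fpsX * fps_sq y) (2 * n) = fps_coef x n.
  rewrite coef_fpsD coef_fps_sq_even -[fpsX]expr1 coef_fpsXnM.
  case: n => [|n]; first by rewrite addr0.
  have -> : (2 * n.+1 = 2 * n + 1 + 1)%N by lia.
  by rewrite addn1 ltnS ltn0 subn1 succnK coef_fps_sq_odd addr0.
have oddE x y n :
    fps_coef (fps_sq x + fpsX * fps_sq y) (2 * n + 1) = fps_coef y n.
  rewrite coef_fpsD coef_fps_sq_odd -[fpsX]expr1 coef_fpsXnM add0r.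
  by rewrite addn1 ltnS ltn0 subn1 succnK coef_fps_sq_even.
by move=> e; split; apply: fpsP => n; [rewrite -(evenE a b n) e|
  rewrite -(oddE a b n) e].
Qed.

End Square.

(** * Shanks' finite identity *)

Section Shanks.
(** [w n] is the product over k < n of (1 - x^(2k+1)) / (1 - x^(2k+2)), specified without
    division. *)
Variables (R : comNzRingType) (x : R) (w : nat -> R).
Hypothesis w0 : w 0 = 1.
Hypothesis wS :
  forall n, w n.+1 * (1 - x ^+ (2 * n + 2)) = w n * (1 - x ^+ (2 * n + 1)).
Hypothesis x_reg : forall n, GRing.rreg (1 - x ^+ (2 * n + 2)).

(** By [wS], each summand is the difference of consecutive right-hand sides. At u = x^(2n+1) this
    supplies the induction step of [shanks_identity]. *)
Lemma shanks_telescope u n :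
  \sum_(s < n.+1) w s * u ^+ s * ((1 - u * x) * x ^+ (2 * s) - (1 - u)) =
  w n * u ^+ n.+1 * (1 - x ^+ (2 * n + 1)).
Proof.
elim: n => [|n IH]; first by rewrite big_ord1 w0 muln0 add0n; ring.
rewrite big_ord_recr /= {}IH.
transitivity (u ^+ n.+1 * (w n * (1 - x ^+ (2 * n + 1))) +
  w n.+1 * u ^+ n.+1 * ((1 - u * x) * x ^+ (2 * n.+1) - (1 - u))).
  by ring.
rewrite -wS (_ : 2 * n.+1 = 2 * n + 2)%N; last lia.
by rewrite addn1 [x ^+ (_ + 2).+1]exprS [u ^+ n.+2]exprS; ring.
Qed.

(* Shanks' finite form of Gauss's identity: the exponents on the left are the
   triangular numbers T(2k) and T(2k+1) for k < n. *)
Lemma shanks_identity n :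
  (\sum_(k < n) (x ^+ (k * (2 * k + 1)) + x ^+ (k.+1 * (2 * k + 1)))) * w n =
  \sum_(s < n) w s * x ^+ (s * (2 * n + 1)).
Proof.
elim: n => [|n IH]; first by rewrite !big_ord0 mul0r.
(* Multiplying by 1 - x^(2n+2) turns [w n.+1] into [w n * (1 - u)], to which the induction
   hypothesis applies. *)
apply: (@x_reg n); set u := x ^+ (2 * n + 1).
have uX k : x ^+ (k * (2 * n + 1)) = u ^+ k by rewrite mulnC exprM.
rewrite -mulrA wS big_ord_recr /= !uX mulrA mulrDl IH.
have -> : \sum_(s < n) w s * x ^+ (s * (2 * n + 1)) =
    \sum_(s < n.+1) w s * u ^+ s - w n * u ^+ n.
  by rewrite big_ord_recr /= addrK; apply: eq_bigr => s _; rewrite uX.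
have -> : 1 - x ^+ (2 * n + 2) = 1 - u * x by rewrite /u addn2 addn1 exprSr.
transitivity ((\sum_(s < n.+1) w s * u ^+ s) * (1 - u) +
              w n * u ^+ n.+1 * (1 - u)).
  by rewrite -/u exprS; ring.
(* The parts with factor 1 - u cancel; what remains carries u^s x^(2s) = x^(s(2n+3)), the power
   required for n + 1. *)
rewrite -shanks_telescope !mulr_suml -big_split /=; apply: eq_bigr => s _.
rewrite (_ : s * _ = s * (2 * n + 1) + 2 * s)%N; last lia.
by rewrite exprD uX; ring.
Qed.

End Shanks.

(** * Euler's and Gauss's product identities, truncated *)

Section Products.
Variable R : comUnitRingType.

(** With X in the role of p, this and the next product are (X^2;X^2)_n and (-X;X^2)_n. *)
Definition euler_prod n : fps R := \prod_(0 <= k < n) (1 - fpsX ^+ (2 * k + 2)).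
Definition odd_prod n : fps R := \prod_(0 <= k < n) (1 + fpsX ^+ (2 * k + 1)).

Lemma euler_prodS n :
  euler_prod n.+1 = euler_prod n * (1 - fpsX ^+ (2 * n + 2)).
Proof. by rewrite /euler_prod big_nat_recr. Qed.

Lemma odd_prodS n : odd_prod n.+1 = odd_prod n * (1 + fpsX ^+ (2 * n + 1)).
Proof. by rewrite /odd_prod big_nat_recr. Qed.

Lemma euler_factor_unit n : (1 - fpsX ^+ (2 * n + 2) : fps R) \is a GRing.unit.
Proof. by rewrite fps_unitE coef_fpsB coef_fpsXn addn2 subr0 unitr1. Qed.

Lemma euler_prod_unit n : euler_prod n \is a GRing.unit.
Proof.
elim: n => [|n IH]; first by rewrite /euler_prod big_geq // unitr1.
by rewrite euler_prodS unitrM IH euler_factor_unit.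
Qed.

(* Truncation of F(z) = sum_n z^n X^(n^2) / (X^2;X^2)_n at z = X^(2N); the
   functional equation is F(z) = (1 + z X) F(X^2 z). *)
Definition odd_prod_series N M : fps R :=
  \sum_(n < M) fpsX ^+ (n * n + 2 * n * N) * (euler_prod n)^-1.

(** Split 1 = X^(2n) + (1 - X^(2n)) in the n-th term: the first part replaces z by X^2 z, the second
    cancels the last factor of the denominator and shifts the index, so its truncation is shorter by
    one. *)
Lemma odd_prod_series_shift N M :
  odd_prod_series N M.+1 =
  odd_prod_series N.+1 M.+1 + fpsX ^+ (2 * N + 1) * odd_prod_series N.+1 M.
Proof.
rewrite /odd_prod_series mulr_sumr 2!big_ord_recl -addrA; congr (_ + _).
rewrite -big_split; apply: eq_bigr => n _ /=; rewrite /bump leq0n add1n.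
have -> : (euler_prod n)^-1 =
    (1 - fpsX ^+ (2 * n + 2)) * (euler_prod n.+1)^-1.
  by rewrite euler_prodS invrM ?euler_prod_unit ?euler_factor_unit // mulVKr
    ?euler_factor_unit.
rewrite !mulrA -mulrDl; congr (_ * _).
have -> : (n.+1 * n.+1 + 2 * n.+1 * N.+1 =
           n.+1 * n.+1 + 2 * n.+1 * N + (2 * n + 2))%N by lia.
rewrite -exprD (_ : 2 * N + 1 + _ = n.+1 * n.+1 + 2 * n.+1 * N)%N; last by lia.
by rewrite [X in _ = X + _]exprD; ring.
Qed.

Lemma odd_prod_series_recr N M :
  fps_eqmod M (odd_prod_series N M.+1) (odd_prod_series N M).
Proof.
rewrite /odd_prod_series big_ord_recr -[X in fps_eqmod _ _ X]addr0.
by apply: eqmodD => //; apply: eqmod_XnM => /=; nia.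
Qed.

Lemma odd_prod_series_step N M :
  fps_eqmod M (odd_prod_series N M)
    ((1 + fpsX ^+ (2 * N + 1)) * odd_prod_series N.+1 M).
Proof.
apply: eqmod_trans (eqmod_sym (@odd_prod_series_recr N M)) _.
rewrite odd_prod_series_shift mulrDl mul1r; apply: eqmodD => //.
exact: odd_prod_series_recr.
Qed.

(** Iterating the functional equation M times extracts the product and leaves F(X^(2M)), which is 1
    modulo X^M. *)
Lemma odd_prod_series_odd_prod M :
  fps_eqmod M (odd_prod_series 0 M) (odd_prod M).
Proof.
have H N : fps_eqmod M (odd_prod_series 0 M)
    (odd_prod N * odd_prod_series N M).
  elim: N => [|N IH]; first by rewrite /odd_prod big_geq // mul1r.
  apply: eqmod_trans IH _; rewrite odd_prodS -mulrA.
  by apply: eqmodM => //; apply: odd_prod_series_step.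
apply: eqmod_trans (H M) _; rewrite -[X in fps_eqmod _ _ X]mulr1.
apply: eqmodM => //; case: M {H} => // M.
rewrite /odd_prod_series big_ord_recl.
rewrite /euler_prod big_geq // invr1 mulr1 expr0.
rewrite -[X in fps_eqmod _ _ X]addr0; apply: eqmodD => //.
apply: eqmod_sum0 => n _; apply: eqmod_XnM.
by rewrite /= /bump leq0n add1n; nia.
Qed.

(* The sum is psi(-X), with psi(X) the sum of X^T over triangular numbers T. *)
Lemma gauss_mod n :
  fps_eqmod n
    ((\sum_(k < n) ((- fpsX) ^+ (k * (2 * k + 1)) +
                    (- fpsX) ^+ (k.+1 * (2 * k + 1)))) * odd_prod n)
    (euler_prod n).
Proof.
(* This is Shanks' w at x = -X: odd powers change sign, even ones do not. *)
pose w n := odd_prod n / euler_prod n.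
have evenX k : (- fpsX : fps R) ^+ (2 * k + 2) = fpsX ^+ (2 * k + 2).
  have -> : (2 * k + 2 = 2 * (k + 1))%N by lia.
  by rewrite !exprM sqrrN.
have oddX k : (- fpsX : fps R) ^+ (2 * k + 1) = - fpsX ^+ (2 * k + 1).
  by rewrite exprNn exprD exprM sqrrN !expr1n mul1r expr1 mulN1r.
have w0 : w 0 = 1 by rewrite /w /odd_prod /euler_prod !big_geq // divr1.
have wS m : w m.+1 * (1 - (- fpsX) ^+ (2 * m + 2)) =
            w m * (1 - (- fpsX) ^+ (2 * m + 1)).
  rewrite /w evenX oddX opprK odd_prodS euler_prodS.
  rewrite invrM ?euler_prod_unit ?euler_factor_unit //.
  have := @euler_factor_unit m; set d := 1 - _ => ud.
  transitivity (odd_prod m * (1 + fpsX ^+ (2 * m + 1)) * (euler_prod m)^-1 *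
                (d^-1 * d)); first by ring.
  by rewrite mulVr // mulr1 mulrAC.
have reg m : GRing.rreg (1 - (- fpsX : fps R) ^+ (2 * m + 2)).
  by rewrite evenX; apply/mulIr/euler_factor_unit.
have := shanks_identity w0 wS reg n; set G := (X in X * w n = _).
move=> GE; rewrite -[X in fps_eqmod _ _ X]mul1r.
rewrite -(divrK (euler_prod_unit n) (odd_prod n)) mulrA -/(w n) GE.
(* Only s = 0 survives modulo X^n, since s(2n + 1) >= n for s > 0. *)
apply: eqmodM => //; case: n {G GE} => [|n] //.
rewrite big_ord_recl w0 mul1r mul0n expr0 -[X in fps_eqmod _ _ X]addr0.
apply: eqmodD => //; apply: eqmod_sum0 => s _.
rewrite exprNn mulrA mulrC; apply: eqmod_XnM.
by rewrite /= /bump leq0n add1n; nia.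
Qed.

End Products.

(** * Truncation of phi(p^2) *)

Lemma fps_sq_prod n :
  fps_sq (\prod_(1 <= k < n.+1) (1 - q ^+ k)) = euler_prod _ n.
Proof.
elim: n => [|n IH]; first by rewrite /euler_prod !big_geq // rmorph1.
rewrite big_nat_recr // rmorphM /= IH euler_prodS rmorphB rmorph1 /=.
by rewrite fps_sqXn mulnS addnC.
Qed.

Lemma euler_phi_mod n :
  fps_eqmod n (fps_sq (euler_phi q)) (euler_prod _ n).
Proof.
move=> i iN; rewrite -fps_sq_prod.
have [M _ cvgM] := euler_phi_cvg int i./2.
rewrite /fps_sq /=; case: odd => //.
have /= <- := cvgM (maxn M n) (leq_maxl _ _).
have : (n <= maxn M n)%N := leq_maxr _ _.
(* Each factor beyond the n-th changes only degrees above n, while [i./2] is below n. *)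
move: (maxn M n) => K; elim: K => [|K IH]; first by rewrite leqn0 => /eqP ->.
rewrite leq_eqVlt ltnS => /orP[/eqP -> //|nK]; rewrite -IH //.
rewrite big_nat_recr // [X in fps_coef X]mulrBr mulr1 [X in _ - X]mulrC.
by rewrite coef_fpsB coef_fpsXnM ifT ?subr0 //; lia.
Qed.

(** * Truncated theta series and the parity split of Gauss's sum *)

Lemma theta_termE (a b : nat) (j : int) (n : nat) :
  a%:Z * (j * (j - 1)) + b%:Z * (j * (j + 1)) = 2 * n%:Z ->
  theta_term (q ^+ a) (q ^+ b) j = q ^+ n.
Proof.
move=> jn; rewrite theta_termXn; congr (_ ^+ _).
move: (tri_predE j) (tri_succE j) (tri_pred_ge0 j) (tri_succ_ge0 j).
move: (_ %/ 2)%Z (_ %/ 2)%Z => x y xE yE x0 y0.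
by nia.
Qed.

Section ThetaTruncation.
Variables a b : nat.
Hypotheses (a_gt0 : (0 < a)%N) (b_gt0 : (0 < b)%N).

(* The two choices of sign s enumerate -m < j <= m and -m <= j < m. *)
Lemma theta_eqmod (s : int) m : s = 1 \/ s = -1 ->
  fps_eqmod m (theta (q ^+ a) (q ^+ b))
    (\sum_(k < m) (theta_term (q ^+ a) (q ^+ b) (s * - k%:Z) +
                   theta_term (q ^+ a) (q ^+ b) (s * k.+1%:Z))).
Proof.
move=> s1.
pose r := [seq s * - k%:Z | k <- index_iota 0 m] ++
          [seq s * k.+1%:Z | k <- index_iota 0 m].
have ur : uniq r.
  rewrite cat_uniq !map_inj_uniq ?iota_uniq /=;
    try (by move=> ? ? /=; case: s1 => ->; lia).
  rewrite andbT; apply/hasPn => j /mapP[k _ ->].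
  by apply/negP => /mapP[l _]; case: s1 => ->; lia.
have jr j : j \notin r -> (m <= `|j|)%N.
  rewrite mem_cat; apply: contraNleq => jm.
  case: (lerP (s * j) 0) => j0; apply/orP; [left|right]; apply/mapP.
    by exists `|j|%N; rewrite ?mem_index_iota; case: s1 j0 => ->; lia.
  by exists `|j|.-1%N; rewrite ?mem_index_iota; case: s1 j0 => ->; lia.
have -> : \sum_(k < m) (theta_term (q ^+ a) (q ^+ b) (s * - k%:Z) +
                   theta_term (q ^+ a) (q ^+ b) (s * k.+1%:Z)) =
          \sum_(j <- r) theta_term (q ^+ a) (q ^+ b) j.
  by rewrite big_split big_cat !big_map !big_mkord.
apply: fps_sum_eqmod => // j /jr mj.
rewrite theta_termXn -[X in fps_eqmod _ X]mulr1; apply: eqmod_XnM.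
exact: leq_trans (theta_exp_ge j a_gt0 b_gt0).
Qed.

End ThetaTruncation.

Lemma theta53_mod m :
  fps_eqmod m (theta (q ^+ 5) (q ^+ 3))
    (\sum_(k < m) (q ^+ (k * (4 * k + 1)) + q ^+ (k.+1 * (4 * k + 3)))).
Proof.
have -> : \sum_(k < m) (q ^+ (k * (4 * k + 1)) + q ^+ (k.+1 * (4 * k + 3))) =
  \sum_(k < m) (theta_term (q ^+ 5) (q ^+ 3) (1 * - k%:Z) +
                theta_term (q ^+ 5) (q ^+ 3) (1 * k.+1%:Z)).
  apply: eq_bigr => k _.
  by congr (_ + _); apply/esym/theta_termE; nia.
by apply: theta_eqmod => //; left.
Qed.

(** The exponent is 4j^2 + 3j; taking s = -1 lists j = k and j = -k - 1, in step with the odd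
    triangular numbers of [gauss_sum_parity]. *)
Lemma theta17_mod m :
  fps_eqmod m (theta q (q ^+ 7))
    (\sum_(k < m) (q ^+ (k * (4 * k + 3)) + q ^+ (k.+1 * (4 * k + 1)))).
Proof.
have -> : \sum_(k < m) (q ^+ (k * (4 * k + 3)) + q ^+ (k.+1 * (4 * k + 1))) =
  \sum_(k < m) (theta_term (q ^+ 1) (q ^+ 7) (-1 * - k%:Z) +
                theta_term (q ^+ 1) (q ^+ 7) (-1 * k.+1%:Z)).
  apply: eq_bigr => k _.
  by congr (_ + _); apply/esym/theta_termE; nia.
by apply: (@theta_eqmod 1 7) => //; right.
Qed.

(** The terms of index 2k and 2k + 1 carry the triangular numbers T(4k), ..., T(4k+3), whose
    parities are even, odd, odd, even. Outside [fps_sq], [q] plays the role of p. *)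
Lemma gauss_sum_parity m :
  \sum_(k < 2 * m) ((- q) ^+ (k * (2 * k + 1)) + (- q) ^+ (k.+1 * (2 * k + 1)))
  = fps_sq (\sum_(k < m) (q ^+ (k * (4 * k + 1)) + q ^+ (k.+1 * (4 * k + 3))))
  - q * fps_sq
      (\sum_(k < m) (q ^+ (k * (4 * k + 3)) + q ^+ (k.+1 * (4 * k + 1)))).
Proof.
rewrite (sum_ord_double (fun k => (- q) ^+ (k * (2 * k + 1)) +
  (- q) ^+ (k.+1 * (2 * k + 1)))).
rewrite !rmorph_sum mulr_sumr -sumrB; apply: eq_bigr => k _ /=.
rewrite !rmorphD /= !fps_sqXn.
have evenX n l : n = (2 * l)%N -> (- q) ^+ n = q ^+ (2 * l).
  by move=> ->; rewrite exprM sqrrN -exprM.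
have oddX n l : n = (2 * l).+1 -> (- q) ^+ n = - (q * q ^+ (2 * l)).
  by move=> ->; rewrite exprS exprM sqrrN -exprM mulNr.
rewrite (@evenX _ (k * (4 * k + 1))%N); last by lia.
rewrite (@oddX _ (k * (4 * k + 3))%N); last by lia.
rewrite (@oddX _ (k.+1 * (4 * k + 1))%N); last by lia.
rewrite (@evenX _ (k.+1 * (4 * k + 3))%N); last by lia.
by ring.
Qed.

(** * The two series and the linear system *)

Definition even_series : fps int := fps_sum (fun i : nat =>
  q ^+ (2 * i ^ 2) / \prod_(1 <= k < (2 * i).+1) (1 - q ^+ k)).

Definition odd_series : fps int := fps_sum (fun i : nat =>
  q ^+ (2 * i ^ 2 + 2 * i) / \prod_(1 <= k < (2 * i + 1).+1) (1 - q ^+ k)).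

Lemma summable_eqmod (e : nat -> nat) (G : nat -> fps int) m :
  (forall i, (i <= e i)%N) ->
  fps_eqmod m (fps_sum (fun i => q ^+ e i * G i))
              (\sum_(i < m) q ^+ e i * G i).
Proof.
move=> ie; rewrite -(big_mkord xpredT (fun i => q ^+ e i * G i)).
apply: fps_sum_eqmod; first exact: iota_uniq.
move=> i; rewrite mem_index_iota -leqNgt => mi.
by apply: eqmod_XnM; apply: leq_trans (ie i).
Qed.

(** Terms 2i and 2i + 1 of Euler's series have numerator exponents 2(2i^2) and 2(2i^2 + 2i) + 1 over
    denominators in X^2, so they give its even and odd parts. *)
Lemma series_mod m :
  fps_eqmod m (fps_sq even_series + q * fps_sq odd_series)
              (odd_prod_series int 0 (2 * m)).
Proof.
have -> : odd_prod_series int 0 (2 * m) =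
  fps_sq (\sum_(i < m)
    q ^+ (2 * i ^ 2) / \prod_(1 <= k < (2 * i).+1) (1 - q ^+ k)) +
  q * fps_sq (\sum_(i < m)
    q ^+ (2 * i ^ 2 + 2 * i) / \prod_(1 <= k < (2 * i + 1).+1) (1 - q ^+ k)).
  rewrite /odd_prod_series (sum_ord_double (fun n =>
    fpsX ^+ (n * n + 2 * n * 0) / euler_prod int n)).
  rewrite !rmorph_sum mulr_sumr -big_split /=; apply: eq_bigr => i _.
  rewrite !rmorphM /= !rmorphV ?even_denom_unit ?odd_denom_unit //=.
  rewrite !fps_sq_prod !fps_sqXn mulrA -exprS.
  by congr (_ ^+ _ / _ + _ ^+ _ / _); nia.
have mm : (m <= 2 * m)%N by lia.
apply: eqmodD; last apply: eqmodM => //.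
  by apply: (eqmod_leq mm); apply: eqmod_sq; apply: summable_eqmod => i; nia.
by apply: (eqmod_leq mm); apply: eqmod_sq; apply: summable_eqmod => i; nia.
Qed.

Lemma euler_gauss_product :
  (fps_sq (theta (q ^+ 5) (q ^+ 3)) - q * fps_sq (theta q (q ^+ 7))) *
  (fps_sq even_series + q * fps_sq odd_series) = fps_sq (euler_phi q).
Proof.
(* Order 2m is used because m pairs of theta terms match 2m pairs in Gauss's sum. *)
apply: eqmodP => m; have mm : (m <= 2 * m)%N by lia.
apply: (eqmod_trans _ (eqmod_leq mm (eqmod_sym (@euler_phi_mod (2 * m))))).
apply: (eqmod_trans _ (eqmod_leq mm (@gauss_mod int (2 * m)))).
apply: eqmodM.
  rewrite gauss_sum_parity; apply: (eqmod_leq mm).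
  apply: eqmodB; first exact/eqmod_sq/theta53_mod.
  by apply: eqmodM => //; exact/eqmod_sq/theta17_mod.
apply: eqmod_trans (@series_mod m) _.
exact: (eqmod_leq mm (@odd_prod_series_odd_prod _ _)).
Qed.

Lemma solve_even_odd (e o A B phi : fps int) :
  e ^+ 2 - q * o ^+ 2 \is a GRing.unit ->
  (fps_sq e - q * fps_sq o) * (fps_sq A + q * fps_sq B) = fps_sq phi ->
  A = phi * e / (e ^+ 2 - q * o ^+ 2) /\ B = phi * o / (e ^+ 2 - q * o ^+ 2).
Proof.
move=> uD prodE.
(* The parts of the product even and odd in p, using that [fps_sq q] is p^2. *)
have [] : e * A - q * o * B = phi /\ e * B - o * A = 0.
  apply: fps_sq_even_odd_inj; rewrite raddf0 mulr0 addr0 -prodE.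
  rewrite !rmorphB !rmorphM /= fps_sqX -/q.
  by move: (fps_sq e) (fps_sq o) (fps_sq A) (fps_sq B) q => ? ? ? ? ?; ring.
move=> phiE /eqP; rewrite subr_eq0 => /eqP BA.
(* Cramer's rule: trading o A for e B gives A D = e phi, and the reverse trade gives B D = o phi,
   where D is the determinant. *)
split; apply: (mulIr uD); rewrite divrK // -phiE.
  transitivity (e * (e * A) - q * o * (o * A)); first by ring.
  by rewrite -BA; ring.
transitivity (e * (e * B) - q * o * (o * B)); first by ring.
by rewrite BA; ring.
Qed.

Theorem lemma5p1 :
  fps_sum (fun i : nat =>
    q ^+ (2 * i ^ 2) / \prod_(1 <= k < (2 * i).+1) (1 - q ^+ k))
  = euler_phi q * theta (q ^+ 5) (q ^+ 3) / D2
  /\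
  fps_sum (fun i : nat =>
    q ^+ (2 * i ^ 2 + 2 * i) / \prod_(1 <= k < (2 * i + 1).+1) (1 - q ^+ k))
  = euler_phi q * theta q (q ^+ 7) / D2.
Proof.
exact: solve_even_odd D2_unit euler_gauss_product.
Qed.
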